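(* Let $L_{\mathcal C}=\{ww\mid w\in\{0,1\}^*\}$ and $L_{\mathrm{cl}}=(1\cup\lambda)(01)^*(0\cup\lambda)$, where $\lambda$ is the empty word. Then $\mathcal G_{L_{\mathcal C}\cap L_{\mathrm{cl}}}$ is exactly the class of (classically) word-representable graphs.
   Context: A graph $G=(V,E)$ is (classically) word-representable if there is a word $w\in V^*$ in which every letter of $V$ occurs such that, for all distinct $u,v\in V$, $\{u,v\}\in E$ iff the letters $u$ and $v$ alternate in $w$ (i.e. deleting all other letters from $w$ gives a word without factor $uu$ or $vv$); equivalently $G\in\mathcal G_{L_{\mathrm{cl}}}$ in the notation below. Graphs are finite, undirected and simple: $G=(V,E)$ with $V$ a finite non-empty set and $E\subseteq\binom{V}{2}$. A language $L\subseteq\{0,1\}^*$ is $0$-$1$-symmetric if it is invariant under the morphism exchanging $0$ and $1$ (the languages here are). For distinct letters $u,v$ of an alphabet $V$, $h_{u,v}:V^*\to\{0,1\}^*$ is the monoid morphism with $u\mapsto 0$, $v\mapsto 1$, and $x\mapsto\lambda$ for all other letters $x$. For a $0$-$1$-symmetric $L$ and a word $w\in V^*$ in which every letter of $V$ occurs, $G(L,w)$ is the graph with vertex set $V$ in which distinct $u,v$ are adjacent if and only if $h_{u,v}(w)\in L$. $\mathcal G_L$ is the class of all graphs $G=(V,E)$ with $G=G(L,w)$ for some $w\in V^*$ in which every letter of $V$ occurs. *)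

(* Defs.v *)
From mathcomp Require Import all_boot.

Set Implicit Arguments.
Unset Strict Implicit.
Unset Printing Implicit Defensive.

(* The letters 0 and 1 are encoded by false and true. *)
Definition language := seq bool -> Prop.

Definition zero_one_symmetric (L : language) : Prop :=
  forall x : seq bool, L x <-> L (map negb x).

Definition langI (L1 L2 : language) : language := fun x => L1 x /\ L2 x.

Definition L_C : language := fun x => exists w : seq bool, x = w ++ w.

(* (1 | lambda) (01)^* (0 | lambda) *)
Definition L_cl : language := fun x =>
  exists (p : seq bool) (n : nat) (s : seq bool),
    [/\ p \in [:: [:: true]; [::]],
        s \in [:: [:: false]; [::]]
      & x = p ++ flatten (nseq n [:: false; true]) ++ s].

Record sgraph := SGraph {
  vertex : finType;
  edge : rel vertex;
  vertex_nonempty : 0 < #|vertex|;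
  edge_sym : symmetric edge;
  edge_irrefl : irreflexive edge }.

Definition letter_proj (V : eqType) (u v x : V) : seq bool :=
  if x == u then [:: false] else if x == v then [:: true] else [::].

Definition h (V : eqType) (u v : V) (w : seq V) : seq bool :=
  flatten (map (letter_proj u v) w).

Definition all_letters_occur (V : finType) (w : seq V) : Prop :=
  forall x : V, x \in w.

(* The adjacency relation of G(L, w); it is symmetric for the languages used
   here, see word_graph_adj_sym and L_C_cl_symmetric below. *)
Definition word_graph_adj (L : language) (V : finType) (w : seq V) (u v : V)
  : Prop := u <> v /\ L (h u v w).

Definition graph_class (L : language) (G : sgraph) : Prop :=
  exists w : seq (vertex G),
    all_letters_occur w /\
    forall u v : vertex G, edge u v <-> word_graph_adj L w u v.

Definition alternate (V : eqType) (u v : V) (w : seq V) : Prop :=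
  let w' := [seq x <- w | (x == u) || (x == v)] in
  ~~ infix [:: u; u] w' /\ ~~ infix [:: v; v] w'.

Definition word_representable (G : sgraph) : Prop :=
  exists w : seq (vertex G),
    all_letters_occur w /\
    forall u v : vertex G, u <> v -> (edge u v <-> alternate u v w).

Lemma h_swap (V : eqType) (u v : V) (w : seq V) :
  u <> v -> h v u w = map negb (h u v w).
Proof.
move=> /eqP uv; rewrite /h map_flatten -map_comp; congr flatten.
apply: eq_map => x /=; rewrite /letter_proj.
case: (eqVneq x v) => [->|_]; first by rewrite [v == u]eq_sym (negbTE uv).
by case: eqP.
Qed.

Lemma word_graph_adj_sym (L : language) (V : finType) (w : seq V) (u v : V) :
  zero_one_symmetric L -> word_graph_adj L w u v <-> word_graph_adj L w v u.
Proof.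
move=> symL.
have swap a b : word_graph_adj L w a b -> word_graph_adj L w b a.
  case=> ne Lh; split; first by move=> e; apply: ne.
  by rewrite h_swap //; apply: (proj1 (symL _)).
by split; exact: swap.
Qed.

Lemma L_C_symmetric : zero_one_symmetric L_C.
Proof.
have neg x : L_C x -> L_C (map negb x).
  by case=> w ->; exists (map negb w); rewrite map_cat.
by move=> x; split=> [|/neg]; [exact: neg | rewrite (mapK negbK)].
Qed.

Lemma L_cl_symmetric : zero_one_symmetric L_cl.
Proof.
have shift n : flatten (nseq n [:: true; false]) ++ [:: true] =
               true :: flatten (nseq n [:: false; true]).
  by elim: n => //= n ->.
have shift0 n : flatten (nseq n.+1 [:: true; false]) =
    [:: true] ++ flatten (nseq n [:: false; true]) ++ [:: false].
  by elim: n => //= n ->.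
have shift1 n : false :: flatten (nseq n [:: true; false]) ++ [:: true] =
                flatten (nseq n.+1 [:: false; true]).
  by rewrite shift.
have shift2 n : false :: flatten (nseq n [:: true; false]) =
                flatten (nseq n [:: false; true]) ++ [:: false].
  by elim: n => //= n <-.
have neg x : L_cl x -> L_cl (map negb x).
  case=> p [n [s [pP sP ->]]].
  rewrite !map_cat map_flatten map_nseq /=.
  move: pP sP; rewrite !inE => /orP[]/eqP-> /orP[]/eqP-> /=.
  - exists [::], n.+1, [::]; split=> //.
    by rewrite shift1 cats0.
  - exists [::], n, [:: false]; split=> //.
    by rewrite cats0 shift2.
  - by exists [:: true], n, [::]; split=> //; rewrite shift cats0.
  - case: n => [|n]; first by exists [::], 0, [::].
    by exists [:: true], n, [:: false]; split=> //; rewrite cats0 shift0.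
by move=> x; split=> [|/neg]; [exact: neg | rewrite (mapK negbK)].
Qed.

Lemma L_C_cl_symmetric : zero_one_symmetric (langI L_C L_cl).
Proof.
move=> x; rewrite /langI; have := L_C_symmetric x; have := L_cl_symmetric x.
tauto.
Qed.

(* Main.v *)
(** A word over {0,1} belongs to [L_cl] iff consecutive letters differ, and to
    [L_C] as well iff moreover both letters occur the same even number of times.
    Appending to [w] a subsequence of [undup w], which lists the letters by last
    occurrence, gives control over the multiplicities: if [u] and [v] alternate
    in [w] and the last of them is [v], then [undup w] restricts to [u v], which
    continues the alternation.

    Given a word-representant, appending repeatedly the letters of [undup w] that
    do not yet occur [K] times makes every letter occur exactly [K] times without
    changing the alternating pairs; doubling the result gives a word in which
    alternating pairs project to squares.  Conversely, given a word for the
    intersection language, one has to destroy the alternation of pairs whose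
    multiplicities are different or odd: group the letters accordingly and append,
    for each group, two copies of its part of [undup w].  This extends
    alternations inside a group and creates a factor [u u] across groups. *)

Require Import Defs.
From mathcomp Require Import all_boot zify.

Set Implicit Arguments.
Unset Strict Implicit.
Unset Printing Implicit Defensive.

Notation alternating := (sorted (frel negb)).

(** * Alternating binary words and alternating squares *)

Section BinaryWords.

Implicit Types (b : bool) (s t : seq bool).

Lemma L_clP t : L_cl t <-> alternating t.
Proof.
have pathP n s : s \in [:: [:: false]; [::]] ->
    path (frel negb) true (flatten (nseq n [:: false; true]) ++ s).
  by rewrite !inE => sP; elim: n => //=; case/orP: sP => /eqP->.
(* Letters are consumed two at a time, hence the induction on a bound for the size. *)
have pathE n : forall s, size s <= n -> path (frel negb) true s ->
    exists m s0, s0 \in [:: [:: false]; [::]] /\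
                 s = flatten (nseq m [:: false; true]) ++ s0.
  elim: n => [|n IHn] [|[] // [|[] // s]] //.
  - by exists 0, [::].
  - by exists 0, [::].
  - by exists 0, [:: false].
  move=> /= /ltnW le_sn /IHn[//|m [s0 [s0P ->]]].
  by exists m.+1, s0.
split=> [[p [n [s [pP sP ->]]]]|].
  have := pathP n s sP; move: pP; rewrite !inE => /orP[]/eqP-> //=.
  exact: path_sorted.
case: t => [|[] t] /= alt_t; first by exists [::], 0, [::].
  have [m [s [sP ->]]] := pathE _ _ (leqnn _) alt_t.
  by exists [:: true], m, s.
have alt_t' : path (frel negb) true (false :: t) by [].
have [m [s [sP ->]]] := pathE _ _ (leqnn _) alt_t'.
by exists [::], m, s.
Qed.

(** The letters of an alternating word pair up from the left; one [b] is left over exactly when the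
    word also ends with [b]. *)
Lemma alternating_count b s : path (frel negb) b s ->
  count_mem b (b :: s) = count_mem (~~ b) (b :: s) + (last b s == b).
Proof.
elim: s b => [|c s IHs] b /=; first by case: b.
case/andP=> /eqP <- /IHs /=; case: (last _ s); case: b => /=; lia.
Qed.

(** Equal counts force a nonempty alternating word to end with the letter other than its first, so
    the junction alternates as well. *)
Lemma alternating_cat_self t : count_mem false t = count_mem true t ->
  alternating (t ++ t) = alternating t.
Proof.
case: t => //= b s; rewrite cat_path /=.
case: (boolP (path _ _ _)) => //= alt_s.
have := alternating_count alt_s => /=.
by case: (last b s); case: b {alt_s} => //=; lia.
Qed.

Lemma L_C_clP t :
  langI L_C L_cl t <->
  alternating t /\
  (count_mem false t = count_mem true t /\ ~~ odd (count_mem false t)).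
Proof.
split=> [[[s ->] /L_clP alt_t]|[alt_t [eq_c even_c]]].
  split=> //; rewrite !count_cat; split; last by rewrite addnn odd_double.
  case: s alt_t => //= b s; rewrite cat_path /= => /and3P[alt_s + _].
  have := alternating_count alt_s => /=.
  by case: (last b s); case: b {alt_s} => //=; lia.
split; last exact/L_clP.
(* The two halves have as length the number of occurrences of [false], written so that its evenness
   is visible. *)
have szE : size t = (count_mem false t)./2.*2 + (count_mem false t)./2.*2.
  rewrite even_halfK // {2}eq_c.
  rewrite -(count_predC (pred1 false) t); congr (_ + _).
  by apply: eq_count => -[].
case: t alt_t szE {eq_c even_c} => [|b s] alt_t szE; first by exists [::].
set m := (_)./2.*2 in szE.
(* An alternating word is an orbit of [negb]; an even number of steps returns to [b], so both halves
   coincide. *)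
have -> : b :: s = traject negb b (size (b :: s)) by rewrite /= -fpathE.
rewrite szE trajectD.
exists (traject negb b m); congr (_ ++ traject _ _ _).
by rewrite /m; elim: (_./2) => //= n ->; rewrite negbK.
Qed.

Lemma undup_bool t : false \in t -> true \in t ->
  undup t = [:: ~~ last false t; last false t].
Proof.
(* Since [undup] keeps last occurrences, it preserves the last letter. *)
have lastE x s : last x (undup s) = last x s.
  elim: s x => //= y s IHs x; case: ifP => [|_] /=; rewrite IHs //.
  by case: s {IHs}.
move=> t0 t1; have := undup_uniq t.
have := mem_undup t false; have := mem_undup t true; rewrite t0 t1 -lastE.
case: (undup t) => [|[] [|[] [|[] ?]]] //=; by rewrite ?inE ?andbF.
Qed.

Lemma alternating_cat_undup t : false \in t -> true \in t ->
  alternating (t ++ undup t) = alternating t.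
Proof.
move=> t0 t1; rewrite undup_bool //; case: t {t0 t1} => //= b s.
by rewrite cat_path /=; case: (last b s); rewrite /= andbT.
Qed.

Lemma alternating_cat_undup2 t : false \in t -> true \in t ->
  alternating (t ++ undup t ++ undup t) = alternating t.
Proof.
move=> t0 t1; rewrite undup_bool //; case: t {t0 t1} => //= b s.
by rewrite cat_path /=; case: (last b s); rewrite /= andbT.
Qed.

(* If [b] is the rarer letter of an alternating word then the word ends with
   [~~ b]. *)
Lemma alternating_cat1 t b : count_mem b t < count_mem (~~ b) t ->
  alternating (t ++ [:: b]) = alternating t.
Proof.
case: t => //= c s; rewrite cat_path /=.
case: (boolP (path _ _ _)) => //= alt_s.
have := alternating_count alt_s => /=.
by case: (last c s); case: c {alt_s}; case: b => //=; lia.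
Qed.

Lemma not_alternating_infix b t : infix [:: b; b] t -> ~~ alternating t.
Proof.
case/infixP=> s1 [s2 ->]; apply/negP=> /cat_sorted2[_] /=.
by case: b.
Qed.

End BinaryWords.

(** * Projection onto two letters *)

Section Projection.

Variables (V : eqType) (u v : V).
Hypothesis neq_uv : u != v.

Implicit Types (w : seq V) (b : bool).

Local Notation letter b := (if b then v else u).

Lemma h_cat w1 w2 : h u v (w1 ++ w2) = h u v w1 ++ h u v w2.
Proof. by rewrite /h map_cat flatten_cat. Qed.

Lemma h_flatten ws : h u v (flatten ws) = flatten (map (h u v) ws).
Proof. by elim: ws => //= w ws <-; rewrite h_cat. Qed.

Lemma h_cons x w : h u v (x :: w) = letter_proj u v x ++ h u v w.
Proof. by []. Qed.

Lemma h_filter (P : pred V) w :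
  h u v (filter P w) = filter (fun b => P (letter b)) (h u v w).
Proof.
elim: w => //= x w IHw; rewrite [in RHS]h_cons filter_cat -IHw.
case: ifP => Px; rewrite ?h_cons /letter_proj;
  by do 2?[case: eqP => [<-|_] /=]; rewrite ?Px.
Qed.

Lemma count_h b w : count_mem b (h u v w) = count_mem (letter b) w.
Proof.
elim: w => //= x w IHw; rewrite h_cons count_cat IHw /letter_proj.
congr (_ + _); clear IHw; have [->|nxu] := eqVneq x u.
  by case: b => /=; rewrite ?eqxx ?(negbTE neq_uv).
by have [->|nxv] := eqVneq x v; case: b => /=;
  rewrite ?eqxx ?[v == u]eq_sym ?(negbTE neq_uv) ?(negbTE nxu) ?(negbTE nxv).
Qed.

Lemma mem_h b w : (b \in h u v w) = (letter b \in w).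
Proof. by rewrite -!has_pred1 !has_count count_h. Qed.

(** By [mem_h], [u] or [v] recurs later in [w] exactly when its image recurs later in the
    projection, so both sides drop the same occurrences. *)
Lemma h_undup w : h u v (undup w) = undup (h u v w).
Proof.
elim: w => //= x w IHw; rewrite [in RHS]h_cons /letter_proj.
have [->|nxu] := eqVneq x u.
  by rewrite /= mem_h /=; case: ifP; rewrite ?h_cons /letter_proj ?eqxx /= IHw.
have [->|nxv] := eqVneq x v.
  rewrite /= mem_h /=; case: ifP; rewrite ?h_cons /letter_proj ?eqxx /= IHw //.
  by rewrite eq_sym (negbTE neq_uv).
case: ifP => //= _.
by rewrite h_cons /letter_proj (negbTE nxu) (negbTE nxv) IHw.
Qed.

Lemma alternateP w : alternate u v w <-> alternating (h u v w).
Proof.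
rewrite /alternate /=; set r := filter _ w.
have -> : h u v w = map (pred1 v) r.
  rewrite /r; elim: w {r} => //= x w IHw; rewrite h_cons IHw /letter_proj.
  have [->|_] /= := eqVneq x u; first by rewrite (negbTE neq_uv).
  by have [->|_] //= := eqVneq x v; rewrite eqxx.
have : all (pred2 u v) r by rewrite filter_all.
suff altE : all (pred2 u v) r ->
    ~~ infix [:: u; u] r && ~~ infix [:: v; v] r = alternating (map (pred1 v) r).
  by move/altE <-; split=> [[-> ->]|/andP].
elim: r => //= x [|y r] IHr; first by case/andP=> /orP[]/eqP-> _; rewrite /= ?andbF.
case/andP=> xP rP; have /andP[yP _] := rP; move: {IHr}(IHr rP) => /= <-.
have nvu : (v == u) = false by rewrite eq_sym (negbTE neq_uv).
by case/orP: xP => /eqP->; case/orP: yP => /eqP->;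
  rewrite ?eqxx ?nvu ?(negbTE neq_uv) /= ?prefix0s ?andbF.
Qed.

End Projection.

(** * Equalizing the multiplicities of the letters *)

Section Uniformization.

Variables (V : finType) (K : nat).

Implicit Types w : seq V.

Definition raise w := w ++ [seq x <- undup w | count_mem x w < K].

Lemma count_raise w x : x \in w ->
  count_mem x (raise w) = count_mem x w + (count_mem x w < K).
Proof.
move=> xw; rewrite count_cat; congr (_ + _).
rewrite count_uniq_mem ?filter_uniq ?undup_uniq //.
by rewrite mem_filter mem_undup xw andbT.
Qed.

Lemma alternate_raise w u v : u != v -> u \in w -> v \in w ->
    count_mem u w <= K -> count_mem v w <= K ->
  alternate u v (raise w) <-> alternate u v w.
Proof.
move=> nuv uw vw leu lev; rewrite !alternateP //.
suff -> : alternating (h u v (raise w)) = alternating (h u v w) by [].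
rewrite h_cat h_filter h_undup //.
have [t0 t1] : false \in h u v w /\ true \in h u v w by rewrite !mem_h.
have := undup_bool t0 t1.
have := count_h nuv true w; have := count_h nuv false w => /=.
set t := h u v w in t0 t1 * => cu cv.
have [ltu|geu] := ltnP (count_mem u w) K;
  have [ltv|gev] := ltnP (count_mem v w) K => undupE.
- rewrite (eq_filter (a2 := predT)); last by case.
  by rewrite filter_predT alternating_cat_undup.
- have -> : [seq b <- undup t | count_mem (if b then v else u) w < K]
    = [:: false].
    by rewrite undupE; case: (last _ t); rewrite /= ltu ltnNge gev.
  by rewrite alternating_cat1 //= cu cv (leq_trans ltu).
- have -> : [seq b <- undup t | count_mem (if b then v else u) w < K]
    = [:: true].
    by rewrite undupE; case: (last _ t); rewrite /= ltv ltnNge geu.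
  by rewrite alternating_cat1 //= cu cv (leq_trans ltv).
- rewrite (eq_filter (a2 := pred0)); first by rewrite filter_pred0 cats0.
  by case; rewrite ltnNge ?geu ?gev.
Qed.

Lemma uniform_word w : all_letters_occur w -> (forall x, count_mem x w <= K) ->
  exists w', [/\ all_letters_occur w', forall x, count_mem x w' = K &
    forall u v, u != v -> alternate u v w' <-> alternate u v w].
Proof.
move=> w_all w_le.
suff [w' [w'_all w'_bnd w'_alt]] : exists w', [/\ all_letters_occur w',
    forall x, K <= count_mem x w' <= K &
    forall u v, u != v -> alternate u v w' <-> alternate u v w].
  exists w'; split=> // x; apply/eqP; rewrite eqn_leq andbC; exact: w'_bnd.
(* Only the lower bound is generalized: each round raises it by one, while the upper bound stays at
   [K]. *)
elim: {1 3}K (leqnn K) => [|n IHn] lenK; first by exists w.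
have [w' [w'_all w'_bnd w'_alt]] := IHn (ltnW lenK).
exists (raise w'); split=> [x|x|u v nuv]; first by rewrite mem_cat w'_all.
  rewrite count_raise //; have := w'_bnd x; lia.
rewrite alternate_raise //; first exact: w'_alt.
- by case/andP: (w'_bnd u).
- by case/andP: (w'_bnd v).
Qed.

End Uniformization.

(** * Destroying alternation between different groups *)

Section Refinement.

Variables (V K : eqType) (f : V -> K).

Definition group_word w :=
  flatten [seq [seq x <- undup w | f x == k] ++ [seq x <- undup w | f x == k]
          | k <- undup (map f w)].

Lemma alternate_group_word w u v : u != v -> u \in w -> v \in w ->
  alternate u v (w ++ group_word w) <-> alternate u v w /\ f u = f v.
Proof.
move=> nuv uw vw; rewrite !alternateP // h_cat h_flatten -map_comp.
have t0 : false \in h u v w by rewrite mem_h.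
have t1 : true \in h u v w by rewrite mem_h.
have := undup_bool t0 t1.
set g := h u v \o _.
have gE k : g k = let s := [seq b <- undup (h u v w)
    | f (if b then v else u) == k] in s ++ s.
  by rewrite /g /= h_cat h_filter h_undup.
set t := h u v w in t0 t1 gE * => undupE.
have fu_in : f u \in undup (map f w) by rewrite mem_undup map_f.
have [fuv|nfuv] := eqVneq (f u) (f v).
  have -> : flatten (map g (undup (map f w))) = undup t ++ undup t.
    (* Blocks of other groups contain neither [u] nor [v], so only the block of [f u] survives the
       projection. *)
    have {}gE k : g k = if k == f u then undup t ++ undup t else [::].
      rewrite gE (eq_filter (a2 := fun=> k == f u)); last first.
        by case; rewrite -?fuv eq_sym.
      by case: (k == f u); rewrite ?filter_predT ?filter_pred0.
    rewrite (eq_map gE); move: fu_in (undup_uniq (map f w)).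
    elim: (undup _) => //= k ks IHks; rewrite inE eq_sym.
    case: eqVneq => [-> _ /andP[nks _]|_ /= kin /andP[_ /(IHks kin)//]].
    suff -> : flatten [seq if k0 == f u then undup t ++ undup t else [::]
                      | k0 <- ks] = [::] by rewrite cats0.
    elim: ks nks {IHks} => //= k0 ks IHks; rewrite inE negb_or eq_sym.
    by case/andP=> /negbTE-> /IHks.
  by rewrite alternating_cat_undup2 //; split=> [|[]].
split=> [|[_ /eqP]]; last by rewrite (negbTE nfuv).
suff /not_alternating_infix/negbTE-> : infix [:: false; false]
    (t ++ flatten (map g (undup (map f w)))) by [].
(* The block of [f u] contains [u] once per copy and never [v]. *)
have gfu : g (f u) = [:: false; false].
  rewrite gE undupE; case: (last _ t);
    by rewrite /= eqxx [f v == _]eq_sym (negbTE nfuv).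
case/splitPr: fu_in => ks1 ks2.
apply/infixP; exists (t ++ flatten (map g ks1)), (flatten (map g ks2)).
by rewrite map_cat flatten_cat /= gfu -catA.
Qed.

End Refinement.

Theorem theorem17 (G : sgraph) :
  graph_class (langI L_C L_cl) G <-> word_representable G.
Proof.
split=> -[w [w_all w_adj]].
  (* A letter of odd multiplicity forms a group of its own, so distinct letters share a group iff
     their multiplicities are equal and even. *)
  pose f x := let n := count_mem x w in (n, if odd n then Some x else None).
  exists (w ++ group_word f w); split=> [x|u v /eqP nuv].
    by rewrite mem_cat w_all.
  rewrite w_adj alternate_group_word // alternateP // /word_graph_adj L_C_clP.
  rewrite !count_h //= /f.
  split=> [[_ [alt_uv [<- /negbTE->]]]|[alt_uv []]] //.
  move=> <-; case: ifP => [_ [/eqP]|_ _]; first by rewrite (negbTE nuv).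
  by split; first exact/eqP.
(* The length of [w] serves as a common bound for all multiplicities. *)
have [||w' [w'_all w'_count w'_alt]] := @uniform_word _ (size w) w => //.
  by move=> x; exact: count_size.
exists (w' ++ w'); split=> [x|u v]; first by rewrite mem_cat w'_all.
have [->|nuv] := eqVneq u v; first by rewrite edge_irrefl; split=> // -[].
rewrite w_adj; last exact/eqP.
have eq_c : count_mem false (h u v w') = count_mem true (h u v w').
  by rewrite !count_h //= !w'_count.
rewrite -w'_alt // alternateP // -alternating_cat_self // -h_cat.
split=> [alt_uv|[_ [_ /L_clP]]] //; split; first exact/eqP.
split; last exact/L_clP.
by exists (h u v w'); rewrite h_cat.
Qed.
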